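(* Let $n\in\mathbb{N}$ be odd. Then $$\frac12\tilde\varrho_n=\frac1n\sum_{\pi\in S_n}(-1)^{\mathsf{peak}(\pi)}\;\frac{2\cdot4\cdots(2\cdot\mathsf{peak}(\pi))}{(n-2)\cdot(n-4)\cdots(n-(2\cdot\mathsf{peak}(\pi)))}\;\pi,$$ where $\mathsf{peak}(\pi):=\#\mathrm{Peak}(\pi)$ for all $\pi\in S_n$ (empty products being $1$).
   Context: $K$ is a field of characteristic $0$. Permutations act on the right ($i\pi$ is the image of $i$) and products in $S_n$ are read from left to right (first $\pi$, then $\sigma$ in $\pi\sigma$). For $\pi\in S_n$: $\mathrm{Des}(\pi)=\{1\le i\le n-1\mid i\pi>(i+1)\pi\}$, $\mathrm{Peak}(\pi)=\{2\le i\le n-1\mid (i-1)\pi<i\pi>(i+1)\pi\}$. A composition of $n$ is a word $q=q_1.\cdots.q_k$ of positive integers with sum $n$; $\ell(q)=k$, and $\Xi^q\in KS_n$ is the sum of all $\pi\in S_n$ with $\mathrm{Des}(\pi)\subseteq\{q_1,q_1+q_2,\ldots,q_1+\cdots+q_{k-1}\}$. The canonical Lie idempotent is $\varrho_n=\sum_q\frac{(-1)^{\ell(q)-1}}{\ell(q)}\Xi^q$, summed over all compositions $q$ of $n$. $\tilde\Xi^n:=2\sum_{\pi\in S_n,\ \mathrm{Peak}(\pi)=\emptyset}\pi$, and $\tilde\varrho_n:=\varrho_n\tilde\Xi^n$ (product in $KS_n$). *)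

(* Defs.v *)
From HB Require Import structures.
From mathcomp Require Import all_boot all_algebra all_fingroup.
Set Implicit Arguments.
Unset Strict Implicit.
Unset Printing Implicit Defensive.
Import GRing.Theory.
Local Open Scope ring_scope.

(* The group algebra K[gT].  This is an alias of {ffun gT -> K}, on which the
   library's multiplication is pointwise: here "*" is the convolution product
   instead. *)
Definition galg (K : fieldType) (gT : finGroupType) : Type := {ffun gT -> K}.

Section GroupAlgebra.
Variables (K : fieldType) (gT : finGroupType).
Implicit Types (a b c : galg K gT) (x y : gT).

HB.instance Definition _ := GRing.Lmodule.copy (galg K gT) {ffun gT -> K^o}.

Definition gelt x : galg K gT := [ffun y => (y == x)%:R].

Definition galg_mul a b : galg K gT :=
  [ffun y => \sum_x a x * b (x^-1 * y)%g].

Lemma galgD a b y : (a + b : galg K gT) y = a y + b y.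
Proof. exact: ffunE. Qed.

Lemma galgZ (k : K) a y : (k *: a : galg K gT) y = k * a y.
Proof. exact: ffunE. Qed.

Lemma galg_mulA : associative galg_mul.
Proof.
move=> a b c; apply/ffunP=> y; rewrite !ffunE.
under eq_bigr do rewrite ffunE mulr_sumr.
under [RHS]eq_bigr do rewrite ffunE mulr_suml.
rewrite [RHS]exchange_big; apply: eq_bigr => x _ /=.
rewrite [RHS](reindex_inj (mulgI x)); apply: eq_bigr => z _ /=.
by rewrite mulKg invMg mulgA mulrA.
Qed.

Lemma galg_mul1l : left_id (gelt 1%g) galg_mul.
Proof.
move=> a; apply/ffunP=> y; rewrite ffunE (bigD1 1%g) //= big1 => [|x /negPf x1].
  by rewrite ffunE eqxx mul1r invg1 mul1g addr0.
by rewrite ffunE x1 mul0r.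
Qed.

Lemma galg_mul1r : right_id (gelt 1%g) galg_mul.
Proof.
move=> a; apply/ffunP=> y; rewrite ffunE (bigD1 y) //= big1 => [|x xy].
  by rewrite ffunE mulVg eqxx mulr1 addr0.
by rewrite ffunE -eq_mulVg1 (negPf xy) mulr0.
Qed.

Lemma galg_mulDl : left_distributive galg_mul +%R.
Proof.
move=> a b c; apply/ffunP=> y; rewrite galgD !ffunE -big_split /=.
by apply: eq_bigr => x _; rewrite galgD mulrDl.
Qed.

Lemma galg_mulDr : right_distributive galg_mul +%R.
Proof.
move=> a b c; apply/ffunP=> y; rewrite galgD !ffunE -big_split /=.
by apply: eq_bigr => x _; rewrite galgD mulrDr.
Qed.

Lemma galg_1neq0 : gelt 1%g != 0.
Proof.
apply/eqP=> /ffunP/(_ 1%g); rewrite !ffunE eqxx => /eqP.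
by rewrite oner_eq0.
Qed.

HB.instance Definition _ := GRing.Zmodule_isNzRing.Build (galg K gT)
  galg_mulA galg_mul1l galg_mul1r galg_mulDl galg_mulDr galg_1neq0.

Lemma galgM a b y : (a * b) y = \sum_x a x * b (x^-1 * y)%g.
Proof. exact: ffunE. Qed.

Lemma galg_scalerAl (k : K) a b : k *: (a * b) = (k *: a) * b.
Proof.
apply/ffunP=> y; rewrite galgZ !ffunE mulr_sumr.
by apply: eq_bigr => x _; rewrite galgZ mulrA.
Qed.

HB.instance Definition _ :=
  GRing.Lmodule_isLalgebra.Build K (galg K gT) galg_scalerAl.

Lemma galg_scalerAr (k : K) a b : k *: (a * b) = a * (k *: b).
Proof.
apply/ffunP=> y; rewrite galgZ !ffunE mulr_sumr.
by apply: eq_bigr => x _; rewrite galgZ mulrCA.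
Qed.

HB.instance Definition _ :=
  GRing.Lalgebra_isAlgebra.Build K (galg K gT) galg_scalerAr.

Lemma geltM x y : gelt (x * y)%g = gelt x * gelt y.
Proof.
apply/ffunP=> z; rewrite !ffunE (bigD1 x) //= big1 => [|t /negPf tx].
  by rewrite !ffunE eqxx mul1r addr0 -(inj_eq (mulgI x^-1%g)) mulKg.
by rewrite ffunE tx mul0r.
Qed.

End GroupAlgebra.

Section Permutations.
Variable n : nat.
Implicit Types (pi : 'S_n) (q : seq nat).

(* The library's product in 'S_n is already read from left to right:
   (pi * sigma) i = sigma (pi i).  Positions i : 'I_n are 0-based, so i stands
   for the position i.+1. *)
Definition Des pi : {set 'I_n} :=
  [set i : 'I_n | [exists j : 'I_n, (j == i.+1 :> nat) && (pi j < pi i)%N]].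

Definition Peak pi : {set 'I_n} :=
  [set i : 'I_n | [exists h : 'I_n, exists j : 'I_n,
    [&& i == h.+1 :> nat, j == i.+1 :> nat,
        (pi h < pi i)%N & (pi j < pi i)%N]]].

Definition peak pi : nat := #|Peak pi|.

Definition is_composition q : bool := all (leq 1) q && (sumn q == n).

(* q_1, q_1 + q_2, ..., q_1 + ... + q_(k-1) *)
Definition partial_sums q : seq nat :=
  [seq sumn (take i q) | i <- iota 1 (size q).-1].

Variable K : fieldType.

Definition Xi q : galg K 'S_n :=
  \sum_(pi : 'S_n | [forall i in Des pi, i.+1 \in partial_sums q]) gelt K pi.

(* A composition of n has at most n parts, each at most n, so all of them occur
   (once each) among the tuples summed over. *)
Definition rho : galg K 'S_n :=
  \sum_(k < n.+1) \sum_(q : k.-tuple 'I_n.+1 | is_composition (map val q))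
    ((-1) ^+ k.-1 / k%:R) *: Xi (map val q).

Definition Xi_tilde : galg K 'S_n :=
  2 *: \sum_(pi : 'S_n | Peak pi == set0) gelt K pi.

Definition rho_tilde : galg K 'S_n := rho * Xi_tilde.

End Permutations.

(* Main.v *)
Require Import Defs.
From mathcomp Require Import all_boot all_algebra all_fingroup.
From mathcomp Require Import zify ring.
Import GRing.Theory.
Local Open Scope ring_scope.

(* A composition of n amounts to a set D of cuts between consecutive positions.
   A V-shaped (peakless) permutation is determined by the letters on its falling
   side, and the number of V-shaped shuffles of the blocks into which D cuts a
   word y is 2^|D| if every block of y is V-shaped, and 0 otherwise.  Hence the
   coefficient of y in half of rho_tilde is the sum of (-2)^|D| / (|D| + 1) over
   the sets D that cut next to each peak of y.  These peaks occupy disjoint pairs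
   of neighbouring cuts, and the sum over all subsets of an even set A of cuts is
   1 / (|A| + 1); imposing the peak conditions one at a time subtracts each time
   the sum in which the two cuts of that pair are forbidden. *)

(** * Weighted sums over the subsets of a finite set *)

Lemma natr_pchar0_eq (K : fieldType) (charK : [pchar K] =i pred0) (a b : nat) :
  (a%:R == b%:R :> K) = (a == b).
Proof.
wlog le_ab : a b / (a <= b)%N.
  by move=> IH; case: (leqP a b) => [|/ltnW] /IH //; rewrite eq_sym => ->; rewrite eq_sym.
rewrite eq_sym -subr_eq0 -natrB // (pcharf0P K).1 //.
by rewrite subn_eq0 eqn_leq le_ab.
Qed.

Lemma sum_subset_card (R : nzRingType) (T : finType) (A : {set T}) (f : nat -> R) :
  \sum_(D : {set T} | D \subset A) f #|D| =
  \sum_(k < #|A|.+1) 'C(#|A|, k)%:R * f k.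
Proof.
rewrite (partition_big (fun D : {set T} => inord #|D| : 'I_(#|A|.+1)) xpredT) //=.
apply: eq_bigr => k _.
under eq_bigr => D /andP[DA /eqP Dk].
  have -> : #|D| = k by rewrite -Dk inordK // ltnS subset_leq_card.
  over.
rewrite sumr_const mulr_natl -cards_draws; congr (_ *+ _).
rewrite -[RHS]sum1_card -sum1_card; apply: eq_bigl => D.
rewrite inE unfold_in; case DA: (D \subset A) => //=.
by rewrite -val_eqE /= inordK // ltnS subset_leq_card.
Qed.

(* The sum is the integral of (1 - 2s)^|A| over [0, 1]. *)
Lemma sum_subset_weight (K : fieldType) (charK : [pchar K] =i pred0)
    (T : finType) (A : {set T}) :
  ~~ odd #|A| ->
  \sum_(D : {set T} | D \subset A) (- 2) ^+ #|D| / #|D|.+1%:R =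
  #|A|.+1%:R^-1 :> K.
Proof.
move=> evenA; rewrite (@sum_subset_card K _ _ (fun k => (- 2) ^+ k / k.+1%:R)).
set a := #|A| in evenA *.
have nz k : k.+1%:R != 0 :> K by rewrite (pcharf0P K).1.
apply: (mulfI (nz a)); rewrite divff // mulr_sumr.
(* The integral is evaluated by expanding [(1 - 2) ^+ a.+1], which is [-1] as [a] is even: once the
   constant term is removed, the diagonal identity for binomials turns the rest into [-2 * a.+1]
   times the sum sought. *)
have := exprDn 1 (- 2 : K) a.+1.
have -> : 1 - 2 = -1 :> K by ring.
rewrite -signr_odd /= evenA expr1 big_ord_recl subn0 expr0 expr1n mulr1 bin0.
move=> /esym/(canRL (addKr _)) H.
have nz2 : - 2 != 0 :> K by rewrite oppr_eq0; exact: nz.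
apply: (mulfI nz2); transitivity (- (1 *+ 1) + -1 : K); last by ring.
rewrite -H mulr_sumr; apply: eq_bigr => k _.
rewrite lift0 expr1n mul1r exprS.
have := congr1 (fun n : nat => n%:R : K) (mul_bin_diag a.+1 k).
rewrite /= !natrM => E.
transitivity ((- 2) ^+ k.+1 * (a.+1%:R * 'C(a, k)%:R) / k.+1%:R : K).
  by rewrite exprS; ring.
rewrite E exprS -mulr_natr; field; by rewrite addrC natr1 nz.
Qed.

(** Write F(p, c) for the right-hand side, with p = [size s] and c = [#|A|.+1]. Requiring one more
    set [b i] to be hit gives F(p + 1, c) = F(p, c) - F(p, c - 2): by disjointness the other pairs
    stay inside [A :\: b i], whose size is again even. *)
Lemma sum_hitting_subset_weight (K : fieldType) (charK : [pchar K] =i pred0)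
    (T I : finType) (b : I -> {set T}) (s : seq I) (A : {set T}) :
  uniq s -> {in s, forall i, b i \subset A} -> {in s, forall i, #|b i| = 2} ->
  {in s &, forall i j, i != j -> [disjoint b i & b j]} -> ~~ odd #|A| ->
  \sum_(D : {set T} | (D \subset A) && all (fun i => ~~ [disjoint b i & D]) s)
    (- 2) ^+ #|D| / #|D|.+1%:R =
  (-1) ^+ size s * (\prod_(1 <= i < (size s).+1) (2 * i)%:R) /
    \prod_(0 <= i < (size s).+1) (#|A|.+1%:R - (2 * i)%:R) :> K.
Proof.
move=> + + b2 + evenA; elim: s A b2 evenA => [|i s IH] A b2 evenA.
  move=> _ _ _; rewrite (eq_bigl (fun D : {set T} => D \subset A)) => [|D]; last exact: andbT.
  by rewrite sum_subset_weight // big_geq // big_nat1 muln0 subr0 !mul1r.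
move=> /= /andP[is_s s_uniq] bA bdisj.
have sub_s j : j \in s -> j \in i :: s by rewrite inE orbC => ->.
have bis j : j \in s -> [disjoint b i & b j].
  move=> js; apply: bdisj; rewrite ?mem_head ?sub_s //.
  by apply: contraNneq is_s => ->.
have cA : #|A| = #|A :\: b i|.+2.
  rewrite -(cardsID (b i) A) (setIidPr _) ?b2 ?mem_head ?bA ?mem_head //.
have evenA' : ~~ odd #|A :\: b i| by rewrite cA /= negbK in evenA.
have := IH A (fun j js => b2 j (sub_s j js)) evenA s_uniq
  (fun j js => bA j (sub_s j js))
  (fun j k js ks => bdisj j k (sub_s j js) (sub_s k ks)).
rewrite (bigID (fun D : {set T} => [disjoint b i & D])) /=.
under eq_bigl => D.
  rewrite andbAC; have -> : (D \subset A) && [disjoint b i & D] = (D \subset A :\: b i).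
    by rewrite subsetD disjoint_sym.
  over.
rewrite IH //; first last.
- by move=> j k js ks; apply: bdisj; apply: sub_s.
- by move=> j js; rewrite subsetD bA ?sub_s // disjoint_sym bis.
- by move=> j js; rewrite b2 ?sub_s.
under [X in _ + X = _]eq_bigl => D do rewrite -andbA [all _ _ && _]andbC.
move=> /(canRL (addKr _)) ->.
set c := #|A|.+1 in evenA *; set p := size s.
(* As [c] is odd, no factor of the denominators vanishes in characteristic 0. *)
have nz k : c%:R - (2 * k)%:R != 0 :> K.
  by rewrite subr_eq0 natr_pchar0_eq //; apply/eqP; lia.
have cE : #|A :\: b i|.+1%:R = c%:R - 2%:R :> K.
  by rewrite /c cA -natrB //; congr (_%:R); lia.
(* The denominators for [A] and for [A :\: b i] both divide this product: the first lacks its last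
   factor, the second its first factor [c]. *)
have shift : \prod_(0 <= k < p.+2) (c%:R - (2 * k)%:R) =
    c%:R * \prod_(0 <= k < p.+1) (#|A :\: b i|.+1%:R - (2 * k)%:R) :> K.
  rewrite big_nat_recl // muln0 subr0; congr (_ * _); apply: eq_bigr => k _.
  by rewrite cE mulnS natrD opprD addrA.
have nzP q : \prod_(0 <= k < q) (c%:R - (2 * k)%:R) != 0 :> K.
  by rewrite prodf_seq_neq0; apply/allP => k _ /=.
have nzc : c%:R != 0 :> K by have := nz 0%N; rewrite muln0 subr0.
rewrite -(canLR (mulKf nzc) shift) -/p.
rewrite (big_nat_recr p.+1 0) // (big_nat_recr p.+1 1) //=.
have := nzP p.+1; have := nz p.+1.
set P := \prod_(0 <= k < _) _; set Q := \prod_(1 <= k < _) _.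
rewrite natrM exprS -[p.+1%:R]natr1 => nz1 nz2; field.
by rewrite nz1 nz2 nzc.
Qed.

(** Only membership outside [B] is free: these sets are [X :|: C :&: B] with [X] any subset of
    [~: B]. *)
Lemma card_sets_with_trace (T : finType) (B C : {set T}) :
  #|[set L : {set T} | L :&: B == C :&: B]| = (2 ^ #|~: B|)%N.
Proof.
rewrite -card_powerset.
have <- : #|[set X :|: C :&: B | X in powerset (~: B)]| = #|powerset (~: B)|.
  apply: card_in_imset.
  move=> X Y; rewrite !inE => XB YB E; apply/setP => v.
  have /setP/(_ v) := E; rewrite !inE.
  have := subsetP XB v; have := subsetP YB v; rewrite !inE.
  by case: (v \in X); case: (v \in Y); case: (v \in B); rewrite ?andbF ?orbF //=;
     do ?[move=> /(_ isT)] => //; move=> _ /(_ isT).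
congr #|pred_of_set _|; apply/setP => L; rewrite inE; apply/eqP/imsetP => [E|[X]].
  exists (L :\: B); first by rewrite inE subsetDr.
  by rewrite -E setUC setID.
rewrite inE => XB ->; apply/setP => v; rewrite !inE.
have := subsetP XB v; rewrite !inE.
by case: (v \in X); case: (v \in C); case: (v \in B) => //= /(_ isT).
Qed.

(** * Peaks and descents in terms of neighbouring positions *)

Lemma in_Peak (m : nat) (y : 'S_m.+1) (i : 'I_m.+1) :
  (i \in Peak y) =
  [&& (0 < i)%N, (i < m)%N, (y (inord i.-1) < y i)%N & (y (inord i.+1) < y i)%N].
Proof.
rewrite inE; apply/existsP/and4P => [[h /existsP[j /and4P[/eqP ih /eqP ji hi jlti]]]|].
  have := ltn_ord j; have := ltn_ord h => hm jm.
  have -> : inord i.-1 = h by apply: ord_inj; rewrite inordK ih.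
  have -> : inord i.+1 = j by apply: ord_inj; rewrite inordK -ji.
  by split=> //; lia.
move=> [i_gt0 im lt1 lt2]; exists (inord i.-1); apply/existsP; exists (inord i.+1).
by apply/and4P; split=> //; rewrite inordK //; lia.
Qed.

Lemma Des_subset (m : nat) (x : 'S_m.+1) (D : {set 'I_m.+1}) :
  (Des x \subset D) =
  [forall (i : 'I_m.+1 | (i < m)%N && (i \notin D)), (x i < x (inord i.+1))%N].
Proof.
apply/subsetP/forall_inP => [H i /andP[im iD]|H i].
  rewrite ltnNge; apply: contra iD => le; apply: H; rewrite inE.
  apply/existsP; exists (inord i.+1); rewrite inordK // eqxx ltn_neqAle le andbT.
  apply/eqP => /ord_inj /perm_inj /(congr1 (@nat_of_ord _)).
  by rewrite inordK //; lia.
rewrite inE => /existsP[j /andP[/eqP ji lt]]; apply: contraLR lt => iD.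
have im : (i < m)%N.
  by have := ltn_ord j; rewrite ji.
have := H i; rewrite im iD => /(_ isT).
have -> : inord i.+1 = j by apply: ord_inj; rewrite inordK -ji.
by rewrite -leqNgt => /ltnW.
Qed.

(** * Peakless permutations as V-shaped words *)

Lemma card_ltn_ord (n : nat) (i : 'I_n) : #|[set j : 'I_n | (j < i)%N]| = i.
Proof.
have le_in : (i <= n)%N by apply: ltnW.
have inj : injective (widen_ord le_in).
  by move=> a b /(congr1 (@nat_of_ord _)) E; apply: ord_inj.
rewrite -[RHS]card_ord -[RHS](card_imset _ inj); apply: eq_card => j; rewrite inE.
apply/idP/imsetP => [ji|[k _ ->]]; last exact: (ltn_ord k).
by exists (Ordinal ji) => //; apply: ord_inj.
Qed.

(* Sorting the letters by this key lists those of [L] in decreasing order and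
   then the others in increasing order. *)
Definition vkey (n : nat) (L : {set 'I_n}) (v : 'I_n) : nat :=
  if v \in L then (n - v)%N else (n + v)%N.

Lemma vkey_inj (n : nat) (L : {set 'I_n}) : injective (vkey n L).
Proof.
move=> v w; rewrite /vkey => E; apply: ord_inj; move: E.
by have := ltn_ord v; have := ltn_ord w; case: (v \in L); case: (w \in L); lia.
Qed.

(** The key of a letter [v] lies at distance [v] from [n], so the side on which the larger letter
    lies decides the comparison alone. *)
Lemma vkey_lt (n : nat) (L : {set 'I_n}) (v w : 'I_n) : (v < w)%N ->
  (vkey n L v < vkey n L w)%N = (w \notin L).
Proof.
move=> vw; rewrite /vkey; have := ltn_ord v; have := ltn_ord w.
by case: (v \in L); case: (w \in L); lia.
Qed.

Lemma vrank_subproof (n : nat) (L : {set 'I_n}) (v : 'I_n) :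
  (#|[set w | (vkey n L w < vkey n L v)%N]| < n)%N.
Proof.
rewrite -[X in (_ < X)%N]card_ord -cardsT; apply: proper_card.
by rewrite properT; apply/eqP => /setP/(_ v); rewrite !inE ltnn.
Qed.

Definition vrank (n : nat) (L : {set 'I_n}) (v : 'I_n) : 'I_n :=
  Ordinal (vrank_subproof n L v).

Lemma vrank_lt (n : nat) (L : {set 'I_n}) (v w : 'I_n) :
  (vrank n L v < vrank n L w)%N = (vkey n L v < vkey n L w)%N.
Proof.
have lt a b : (vkey n L a < vkey n L b)%N -> (vrank n L a < vrank n L b)%N.
  move=> ab; apply: proper_card; apply/properP; split.
    by apply/subsetP => c; rewrite !inE => /ltn_trans; apply.
  by exists a; rewrite !inE ?ltnn.
case: (ltngtP (vkey n L v) (vkey n L w)) => [/lt //|/lt wv|/vkey_inj ->].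
  by apply/negbTE; rewrite -leqNgt ltnW.
by rewrite ltnn.
Qed.

Lemma vrank_inj (n : nat) (L : {set 'I_n}) : injective (vrank n L).
Proof.
move=> v w E; apply: (@vkey_inj n L).
have := vrank_lt n L v w; have := vrank_lt n L w v; rewrite E ltnn.
by case: ltngtP.
Qed.

(** [vrank] gives each letter its position, whereas a word gives each position its letter: hence the
    inverse. *)
Definition vword (n : nat) (L : {set 'I_n}) : 'S_n := (perm (vrank_inj n L))^-1%g.

Lemma vword_lt (n : nat) (L : {set 'I_n}) (v w : 'I_n) :
  ((vword n L)^-1%g v < (vword n L)^-1%g w)%N = (vkey n L v < vkey n L w)%N.
Proof. by rewrite invgK !permE vrank_lt. Qed.

Lemma vkey_vword (n : nat) (L : {set 'I_n}) (i j : 'I_n) :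
  (vkey n L (vword n L i) < vkey n L (vword n L j))%N = (i < j)%N.
Proof. by rewrite -vword_lt !permK. Qed.

(** The letter at a peak would lie outside [L], because a smaller letter precedes it, and inside
    [L], because a smaller letter follows it. *)
Lemma Peak_vword (m : nat) (L : {set 'I_m.+1}) : Peak (vword m.+1 L) = set0.
Proof.
apply/setP => i; rewrite in_Peak in_set0; apply/negP => /and4P[i_gt0 im lt1 lt2].
have := vkey_vword _ L (inord i.-1) i; have := vkey_vword _ L i (inord i.+1).
rewrite (vkey_lt _ _ _ _ lt1) !inordK; [|lia|lia].
rewrite ltnNge leq_eqVlt (vkey_lt _ _ _ _ lt2).
by case: (_ \in L); rewrite ?orbT /=; lia.
Qed.

(** The letter 0 has key [n] whether or not it belongs to [L], so [L] is normalised to avoid it.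
    Then [L] is recovered as the set of letters standing before 0. *)
Lemma vword_inj (m : nat) :
  {in [pred L : {set 'I_m.+1} | ord0 \notin L] &, injective (vword m.+1)}.
Proof.
have memE (L : {set 'I_m.+1}) v : ord0 \notin L ->
    (v \in L) = ((vword m.+1 L)^-1%g v < (vword m.+1 L)^-1%g ord0)%N.
  move=> L0; rewrite vword_lt /vkey (negPf L0) addn0.
  have := ltn_ord v; case: (boolP (v \in L)) => [vL|]; last lia.
  suff : nat_of_ord v != 0 by lia.
  by apply: contraNneq L0 => v0; rewrite (_ : ord0 = v) //; apply: ord_inj.
by move=> L L' L0 L0' E; apply/setP => v; rewrite (memE L) // (memE L') // E.
Qed.

(** Without peaks an ascent is followed by ascents only, so the word falls to the letter 0, at
    position [c], and rises from there on. *)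
Lemma peakless_vword (m : nat) (z : 'S_m.+1) : Peak z = set0 ->
  exists2 L : {set 'I_m.+1}, ord0 \notin L & z = vword m.+1 L.
Proof.
move=> Pz; pose c := z^-1%g ord0; pose Z k := nat_of_ord (z (inord k)).
have cm : (c <= m)%N by rewrite -ltnS.
have Zc : Z c = 0 by rewrite /Z inord_val permKV.
have Zinj k l : (k <= m)%N -> (l <= m)%N -> Z k = Z l -> k = l.
  move=> km lm /ord_inj /perm_inj /(congr1 (@nat_of_ord _)).
  by rewrite !inordK.
have step k : (k.+2 <= m)%N -> (Z k < Z k.+1)%N -> (Z k.+1 < Z k.+2)%N.
  move=> km lt; have /setP/(_ (inord k.+1)) := Pz.
  rewrite in_Peak in_set0 inordK; last lia.
  rewrite /= -/(Z k) -/(Z k.+1) -/(Z k.+2) lt km /= => /negbT.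
  rewrite -leqNgt leq_eqVlt => /predU1P[] // /Zinj; lia.
have neq k : (k < m)%N -> Z k <> Z k.+1 by move=> km /Zinj; lia.
have base k : c = k :> nat -> (k < m)%N -> (Z k < Z k.+1)%N.
  by move=> ck /neq; move: Zc; rewrite ck; lia.
have right k : (c <= k)%N -> (k < m)%N -> (Z k < Z k.+1)%N.
  elim: k => [|k IH] ck km; first by apply: base; lia.
  case: (ltngtP c k.+1) ck => // [ck|/base H] _; last exact: H.
  by apply: step => //; apply: IH; lia.
(* The induction runs on the distance to [c]: an ascent at [k] would force an ascent at [k.+1],
   against the induction hypothesis. *)
have left d : forall k, (k + d.+1)%N = c -> (Z k.+1 < Z k)%N.
  elim: d => [|d IH] k kc.
    have /neq : (k < m)%N by lia.
    by rewrite addn1 in kc; rewrite kc Zc; lia.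
  have := IH k.+1; have := step k; have : Z k <> Z k.+1 by apply: neq; lia.
  by lia.
(* The falling side consists of the letters placed before 0. *)
pose L := [set v | (z^-1%g v < c)%N]; exists L; first by rewrite inE ltnn.
have Lz (i : 'I_m.+1) : (z i \in L) = (i < c)%N by rewrite inE permK.
pose k i := vkey m.+1 L (z (inord i)).
have kE i : (i <= m)%N -> k i = (if (i < c)%N then (m.+1 - Z i)%N else (m.+1 + Z i)%N).
  by move=> im; rewrite /k /vkey Lz inordK.
have k_homo : {in [pred i | (i < m.+1)%N] &, {homo k : i j / (i < j)%N}}.
  apply: homo_ltn_in.
  - by move=> *; lia.
  - by move=> i j _; rewrite inE => jm l /andP[_ lj]; rewrite inE; lia.
  move=> i; rewrite !inE => im im'; rewrite !kE //.
  have Zm : (Z i < m.+1)%N by exact: ltn_ord.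
  have Zm' : (Z i.+1 < m.+1)%N by exact: ltn_ord.
  case: (ltnP i c) => ic; case: (ltnP i.+1 c) => ic'.
  - by have := left (c - i.+1)%N i; lia.
  - by have := left (c - i.+1)%N i; lia.
  - by lia.
  - by have := right i; lia.
have kz (i j : 'I_m.+1) : (i < j)%N -> (vkey m.+1 L (z i) < vkey m.+1 L (z j))%N.
  by move=> ij; have := k_homo i j (ltn_ord i) (ltn_ord j) ij; rewrite /k !inord_val.
have kzE (i j : 'I_m.+1) : (vkey m.+1 L (z i) < vkey m.+1 L (z j))%N = (i < j)%N.
  case: (ltngtP i j) => [/kz //|/kz ji|/ord_inj ->]; last by rewrite ltnn.
  by apply/negbTE; rewrite -leqNgt ltnW.
apply: invg_inj; apply/permP => v; rewrite invgK [RHS]permE.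
have [i ->] : exists i, v = z i by exists (z^-1%g v); rewrite permKV.
rewrite permK; apply: ord_inj.
(* Keys increase along the word, so the letters before position [i] are those of smaller key than
   [z i], and [i] is the rank of [z i]. *)
rewrite -[LHS](card_ltn_ord _ i) -[LHS](card_imset _ (@perm_inj _ z)).
apply: eq_card => w; rewrite -[w](permKV z) mem_imset; last exact: perm_inj.
by rewrite !inE kzE.
Qed.

(* The cut [i] lies between the 0-based positions [i] and [i.+1]. *)
Definition cuts (m : nat) : {set 'I_m.+1} := [set i : 'I_m.+1 | (i < m)%N].

Lemma card_cuts (m : nat) : #|cuts m| = m.
Proof.
rewrite -[RHS]/(nat_of_ord (@ord_max m)) -card_ltn_ord.
by apply: eq_card => i; rewrite !inE.
Qed.

(** * Peaks and the pairs of cuts on either side of them *)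

Definition peak_cuts (m : nat) (i : 'I_m.+1) : {set 'I_m.+1} := [set inord i.-1; i].

Lemma peak_cuts_sub (m : nat) (y : 'S_m.+1) (i : 'I_m.+1) :
  i \in Peak y -> peak_cuts m i \subset cuts m.
Proof.
rewrite in_Peak => /and4P[i_gt0 im _ _]; apply/subsetP => j.
by rewrite !inE => /orP[] /eqP -> //; rewrite inordK; lia.
Qed.

Lemma card_peak_cuts (m : nat) (y : 'S_m.+1) (i : 'I_m.+1) :
  i \in Peak y -> #|peak_cuts m i| = 2.
Proof.
rewrite in_Peak => /and4P[i_gt0 im _ _]; rewrite cards2.
suff -> : inord i.-1 != i by [].
by apply/eqP => /(congr1 (@nat_of_ord _)); rewrite inordK; lia.
Qed.

(** A common cut would make the two peaks adjacent, and each of their letters would then exceed the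
    other. *)
Lemma peak_cuts_disjoint (m : nat) (y : 'S_m.+1) (i j : 'I_m.+1) :
  i \in Peak y -> j \in Peak y -> i != j ->
  [disjoint peak_cuts m i & peak_cuts m j].
Proof.
wlog ij : i j / (i < j)%N.
  move=> H iP jP; case: (ltngtP i j) => [ij|ji|/ord_inj ->]; last by rewrite eqxx.
  - exact: H.
  - by rewrite eq_sym disjoint_sym; apply: H.
rewrite !in_Peak => /and4P[i_gt0 im _ i2] /and4P[j_gt0 jm j1 _] _.
rewrite disjoint_subset; apply/subsetP => k; rewrite !inE.
suff ij1 : i <> j.-1 :> nat.
  by case/orP => /eqP ->; apply/norP; split; apply/eqP;
     move=> /(congr1 (@nat_of_ord _)); rewrite ?inordK; lia.
move=> E; have ji : inord i.+1 = j by apply: ord_inj; rewrite inordK; lia.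
have ij' : inord j.-1 = i by apply: ord_inj; rewrite inordK; lia.
by move: i2 j1; rewrite ji ij'; lia.
Qed.

(** * Counting the V-shaped shuffles of the blocks of a word *)

Definition hits_peaks (m : nat) (y : 'S_m.+1) (D : {set 'I_m.+1}) : bool :=
  all (fun i => ~~ [disjoint peak_cuts m i & D]) (enum (Peak y)).

(* [x^-1 * y] is a shuffle of the blocks into which [D] cuts the word [y].  It is
   [vword L], and each uncut position of [y] decides whether the larger of the
   two letters around it lies in [L]; two such positions concern the same letter
   exactly at a peak that [D] does not hit. *)
Lemma card_peakless_shuffles (m : nat) (y : 'S_m.+1) (D : {set 'I_m.+1}) :
  D \subset cuts m ->
  #|[set x : 'S_m.+1 | (Des x \subset D) && (Peak (x^-1 * y)%g == set0)]| =
  if hits_peaks m y D then (2 ^ #|D|)%N else 0.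
Proof.
move=> DA; pose nx (i : 'I_m.+1) : 'I_m.+1 := inord i.+1.
have nxK (i : 'I_m.+1) : (i < m)%N -> nx i = i.+1 :> nat by move=> im; rewrite inordK.
pose N := cuts m :\: D; pose desc i := (y (nx i) < y i)%N.
have inN i : (i \in N) = (i < m)%N && (i \notin D) by rewrite !inE andbC.
(* The larger of the two letters around the cut [i]. *)
pose mx i := if desc i then y i else y (nx i).
have y_nx i : i \in N -> y i <> y (nx i) :> nat.
  rewrite inN => /andP[im _] /ord_inj /perm_inj /(congr1 (@nat_of_ord _)).
  by rewrite nxK; lia.
(* At an uncut position the two letters of [y] must keep their order in [vword L]; by [vkey_lt] this
   says that the larger one lies in [L] exactly when it comes first in [y]. *)
have condE L : (Des (y * (vword m.+1 L)^-1)%g \subset D) =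
    [forall i in N, (mx i \in L) == desc i].
  rewrite Des_subset; apply: eq_forallb => i; rewrite -inN.
  case: (boolP (i \in N)) => iN //=.
  rewrite !permM vword_lt -/(nx i) /mx; have := y_nx i iN.
  case: (boolP (desc i)) => [dlt _|]; last first.
    rewrite /desc -leqNgt leq_eqVlt => /predU1P[->|lt _] //.
    by rewrite (vkey_lt _ _ _ _ lt) eqbF_neg.
  rewrite eqb_id -[_ \in L]negbK -(vkey_lt _ _ _ _ dlt) -leqNgt [RHS]leq_eqVlt.
  suff -> : (vkey m.+1 L (y i) == vkey m.+1 L (y (nx i))) = false by [].
  by apply/eqP => /vkey_inj E; move: dlt; rewrite /desc E ltnn.
pose S := [set L : {set 'I_m.+1} | (ord0 \notin L) &&
  [forall i in N, (mx i \in L) == desc i]].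
(* The equation [x^-1 * y = vword L] matches the permutations [x] with the normalised sets [L]. *)
transitivity #|S|.
  pose F L := (y * (vword m.+1 L)^-1)%g.
  have FI : {in S &, injective F}.
    move=> L L'; rewrite !inE => /andP[L0 _] /andP[L'0 _] /mulgI /invg_inj.
    exact: vword_inj.
  rewrite -(card_in_imset FI); apply: eq_card => x; rewrite inE.
  apply/andP/imsetP => [[xD /eqP xy]|[L]].
    have [L L0 E] := peakless_vword _ _ xy.
    have xE : x = F L by rewrite /F -E invMg invgK mulKVg.
    by exists L => //; rewrite inE L0 -condE -/(F L) -xE.
  rewrite inE -condE => /andP[L0 LD] ->; split=> //.
  by rewrite invMg invgK mulgKV Peak_vword.
(* Uncut positions [i < j] share their larger letter only if [j = i.+1], with an ascent at [i] and a
   descent at [j]: then [j] is a peak that [D] does not hit. *)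
have mx_inj_lt i j : hits_peaks m y D -> i \in N -> j \in N -> (i < j)%N -> mx i <> mx j.
  move=> /allP hits iN jN ij; have := iN; have := jN.
  rewrite !inN => /andP[jm jD] /andP[im iD].
  have neq (k l : 'I_m.+1) : k <> l :> nat -> y k <> y l.
    by move=> kl /perm_inj E; apply: kl; rewrite E.
  rewrite /mx; case: (boolP (desc i)) => di; case: (boolP (desc j)) => dj;
    try by apply: neq; rewrite ?nxK; lia.
  move/perm_inj => E; have jP : j \in Peak y.
    rewrite in_Peak; apply/and4P; split=> //; first by lia.
    have -> : inord j.-1 = i by apply: ord_inj; rewrite -E nxK // inordK //=; lia.
    by rewrite -E; have := y_nx i iN; move: di; rewrite /desc; lia.
  have := hits j; rewrite mem_enum => /(_ jP); apply/negP; rewrite negbK.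
  have -> : peak_cuts m j = [set i; j].
    by rewrite /peak_cuts; congr [set _; j]; apply: ord_inj; rewrite -E nxK // inordK //=; lia.
  by rewrite disjoint_subset; apply/subsetP => k; rewrite !inE => /orP[] /eqP ->.
(* At a peak that is not hit, the ascent before it excludes its letter from [L] while the descent
   after it puts that letter in [L], so [S] is empty. *)
case: ifP => hits; last first.
  apply/eqP; rewrite cards_eq0 -subset0; apply/subsetP => L.
  rewrite inE => /andP[_ /forall_inP LN].
  have /allPn[i] := negbT hits; rewrite mem_enum negbK => iP.
  have iA := peak_cuts_sub _ _ _ iP; move: (iP).
  rewrite in_Peak => /and4P[i_gt0 im lt1 lt2] dis.
  have inN' k : k \in peak_cuts m i -> k \in N.
    by move=> ki; rewrite inE (disjointFr dis ki) (subsetP iA).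
  have pnx : nx (inord i.-1) = i by apply: ord_inj; rewrite nxK inordK; lia.
  have := LN _ (inN' (inord i.-1) _); have := LN _ (inN' i _).
  rewrite !inE !eqxx orbT /mx {1 2}/desc lt2 => /(_ isT)/eqP iL /(_ isT).
  by rewrite /desc pnx ltnNge (ltnW lt1) /= iL.
have mx_inj : {in N &, injective mx}.
  move=> i j iN jN E; apply: ord_inj; case: (ltngtP i j) => //.
  - by move/(mx_inj_lt i j hits iN jN).
  - by move/(mx_inj_lt j i hits jN iN); rewrite E.
have mx0 i : i \in N -> mx i != ord0.
  move=> iN; apply/eqP => /(congr1 (@nat_of_ord _)); rewrite /mx /=; have := y_nx i iN.
  by rewrite /desc; case: (ltnP (y (nx i)) (y i)); lia.
(* [B] holds the letters whose membership in [L] is prescribed, and [C] those among them that must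
   belong to it. *)
pose B := ord0 |: mx @: N; pose C := mx @: [set i in N | desc i].
have mxC i : i \in N -> (mx i \in C) = desc i.
  move=> iN; apply/imsetP/idP => [[j] | di]; last first.
    by exists i => //; rewrite inE iN.
  by rewrite inE => /andP[jN dj] /mx_inj -> //.
have C0 : ord0 \notin C.
  by apply/imsetP => -[j]; rewrite inE => /andP[/mx0/eqP j0 _] E; case: j0.
have -> : S = [set L | L :&: B == C :&: B].
  apply/setP => L; rewrite !inE; apply/andP/eqP => [[L0 /forall_inP LN]|E].
    apply/setP => v; rewrite !inE; case: eqP => [->|_] /=.
      by rewrite (negPf L0) (negPf C0).
    case: (boolP (v \in mx @: N)) => [/imsetP[i iN ->]|]; last by rewrite !andbF.
    by rewrite mxC // (eqP (LN i iN)).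
  have memE v : v \in B -> (v \in L) = (v \in C).
    by move=> vB; have /setP/(_ v) := E; rewrite !(in_setI, vB) !andbT.
  split; first by rewrite memE // setU11.
  by apply/forall_inP => i iN; rewrite memE ?mxC // setU1r // imset_f.
rewrite card_sets_with_trace; congr (2 ^ _)%N.
(* By injectivity [B] has [m - #|D| + 1] of the [m + 1] letters, which leaves [#|D|] letters
   free. *)
have := cardsC B; rewrite cardsU1 (card_in_imset mx_inj) card_ord.
have -> : ord0 \notin mx @: N by apply/negP => /imsetP[j /mx0/eqP j0 E]; apply: j0.
have := cardsID D (cuts m); rewrite (setIidPr DA) card_cuts -/N.
rewrite add1n => H1 /eqP; rewrite addSn eqSS -[X in _ == X]H1 addnC.
by rewrite eqn_add2r => /eqP.
Qed.

(** * Compositions and sets of cuts *)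

Lemma scanl_addn (q : seq nat) : q != [::] ->
  scanl addn 0 q = rcons (partial_sums q) (sumn q).
Proof.
have foldlE a s : foldl addn a s = (a + sumn s)%N.
  by elim: s a => [|x s IH] a /=; rewrite ?addn0 // IH addnA.
case: q => [//|x q] _; set r := x :: q.
have sz : size (partial_sums r) = size q by rewrite size_map size_iota.
apply: (@eq_from_nth _ 0) => [|i]; rewrite size_scanl ?size_rcons ?sz // => ir.
rewrite nth_scanl // foldlE nth_rcons sz add0n.
case: (ltngtP i (size q)) => [iq|iq|->]; last by rewrite take_oversize.
- by rewrite (nth_map 0) ?size_iota // nth_iota // add1n.
- by move: ir; rewrite ltnS leqNgt iq.
Qed.

Lemma path_scanl_addn (a : nat) (q : seq nat) :
  path ltn a (scanl addn a q) = all (leq 1) q.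
Proof. by elim: q a => //= x q IH a; rewrite IH -{1}[a]addn0 ltn_add2l. Qed.

(** The increasing path makes the truncated subtractions exact, so taking differences and then
    partial sums loses nothing. *)
Lemma scanl_pairmap (a : nat) (s : seq nat) : path ltn a s ->
  scanl addn a (pairmap (fun x y => (y - x)%N) a s) = s.
Proof. by elim: s a => //= x s IH a /andP[ax xs]; rewrite subnKC ?IH // ltnW. Qed.

Definition comp_cuts (m : nat) (q : seq nat) : {set 'I_m.+1} :=
  [set i : 'I_m.+1 | i.+1 \in partial_sums q].

Definition cut_seq (m : nat) (D : {set 'I_m.+1}) : seq nat :=
  [seq (nat_of_ord i).+1 | i <- enum D].

Lemma cut_seq_sorted (m : nat) (D : {set 'I_m.+1}) : sorted ltn (cut_seq m D).
Proof.
rewrite /cut_seq sorted_map /enum_mem; apply: sorted_filter.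
  by move=> j i k; exact: ltn_trans.
rewrite -enumT; have := iota_ltn_sorted 0 m.+1.
by rewrite -val_enum_ord sorted_map.
Qed.

Lemma composition_path (n : nat) (q : seq nat) : (0 < n)%N -> is_composition n q ->
  path ltn 0 (rcons (partial_sums q) n).
Proof.
move=> n_gt0 /andP[q_gt0 /eqP qn]; rewrite -qn -scanl_addn ?path_scanl_addn //.
by apply: contraTneq n_gt0 => q0; rewrite -qn q0.
Qed.

(** Both lists are strictly increasing, so it suffices that they have the same elements. *)
Lemma partial_sums_cut_seq (m : nat) (q : seq nat) : is_composition m.+1 q ->
  partial_sums q = cut_seq m (comp_cuts m q).
Proof.
move=> /(composition_path _ _ (ltn0Sn m)) qm.
have := qm; rewrite rcons_path => /andP[/path_sorted q_sorted _].
apply: (irr_sorted_eq ltn_trans ltnn) => [//||j]; first exact: cut_seq_sorted.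
apply/idP/mapP => [jq|[i]]; last by rewrite mem_enum inE => iq ->.
have j_gt0 : (0 < j)%N.
  have := order_path_min ltn_trans qm; rewrite all_rcons => /andP[_ /allP]; exact.
have jm : (j < m.+1)%N.
  have := path_sorted qm.
  (* Reversal brings the total [m.+1] to the head, where sortedness bounds all other entries by
     it. *)
  rewrite -[sorted _ _]rev_sorted rev_rcons /= path_sortedE => [/andP[/allP H _]|].
    by apply: H; rewrite mem_rev.
  by move=> a b c /= ab bc; apply: ltn_trans bc ab.
exists (inord j.-1); last by rewrite inordK; lia.
by rewrite mem_enum inE inordK ?prednK //; lia.
Qed.

Lemma card_comp_cuts (m : nat) (q : seq nat) : is_composition m.+1 q ->
  #|comp_cuts m q|.+1 = size q.
Proof.
move=> qm; have := congr1 size (partial_sums_cut_seq m q qm).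
rewrite !size_map -cardE size_iota => <-; rewrite prednK // lt0n size_eq0.
by apply: contraTneq qm => ->.
Qed.

Lemma comp_cuts_sub (m : nat) (q : seq nat) : is_composition m.+1 q ->
  comp_cuts m q \subset cuts m.
Proof.
move=> /(composition_path _ _ (ltn0Sn m)) /path_sorted qm.
apply/subsetP => i; rewrite !inE => iq; move: qm.
rewrite -[sorted _ _]rev_sorted rev_rcons /= path_sortedE => [/andP[/allP H _]|].
  by rewrite -ltnS; apply: H; rewrite mem_rev.
by move=> a b c /= ab bc; apply: ltn_trans bc ab.
Qed.

Lemma comp_cuts_inj (m : nat) (q r : seq nat) :
  is_composition m.+1 q -> is_composition m.+1 r ->
  comp_cuts m q = comp_cuts m r -> q = r.
Proof.
have K : forall x, cancel (addn x) (fun y => (y - x)%N) by move=> x y; rewrite addKn.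
have neq0 s : is_composition m.+1 s -> s != [::] by apply: contraTneq => ->.
move=> qm rm E; rewrite -(scanlK K 0 q) -(scanlK K 0 r) !scanl_addn ?neq0 //.
rewrite !(partial_sums_cut_seq m) // E.
by case/andP: qm => _ /eqP ->; case/andP: rm => _ /eqP ->.
Qed.

Lemma comp_cuts_surj (m : nat) (D : {set 'I_m.+1}) : D \subset cuts m ->
  exists2 q, is_composition m.+1 q & comp_cuts m q = D.
Proof.
move=> Dm; pose s := rcons (cut_seq m D) m.+1.
have sP : path ltn 0 s.
  rewrite rcons_path path_sortedE; last exact: ltn_trans.
  rewrite cut_seq_sorted andbT; apply/andP; split; first by apply/allP => j /mapP[i _ ->].
  have := mem_last 0 (cut_seq m D); rewrite inE => /predU1P[-> //|/mapP[i]].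
  by rewrite mem_enum => /(subsetP Dm); rewrite inE => im ->.
(* The parts are the gaps between consecutive terms of 0, the cuts and the total [m.+1]. *)
pose q := pairmap (fun x y => (y - x)%N) 0 s.
have qs : scanl addn 0 q = s by apply: scanl_pairmap.
have q0 : q != [::] by rewrite -size_eq0 size_pairmap size_rcons.
move: (qs); rewrite scanl_addn // => /rcons_inj[psq sq].
exists q; first by rewrite /is_composition sq eqxx andbT -(path_scanl_addn 0) qs.
apply/setP => i; rewrite inE psq; apply/mapP/idP => [[j]|iD].
  by rewrite mem_enum => jD [] /ord_inj ->.
by exists i; rewrite ?mem_enum.
Qed.

(** * Coefficients of [rho] and [rho_tilde] *)

Lemma galg_sumE (K : fieldType) (gT : finGroupType) (I : Type) (r : seq I)
    (P : pred I) (F : I -> galg K gT) (x : gT) :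
  (\sum_(i <- r | P i) F i) x = \sum_(i <- r | P i) F i x.
Proof. by elim/big_rec2: _ => [|i a b _ <-]; rewrite ?ffunE // galgD. Qed.

Lemma galg_sum_gelt (K : fieldType) (gT : finGroupType) (f : gT -> K) (x : gT) :
  (\sum_y f y *: gelt K y) x = f x.
Proof.
rewrite galg_sumE (bigD1 x) //= big1 => [|y /negPf yx].
  by rewrite galgZ ffunE eqxx mulr1 addr0.
by rewrite galgZ ffunE eq_sym yx mulr0.
Qed.

Lemma galg_sum_geltP (K : fieldType) (gT : finGroupType) (P : pred gT) (x : gT) :
  (\sum_(y | P y) gelt K y) x = (P x)%:R.
Proof.
rewrite big_mkcond (eq_bigr (fun y => (P y)%:R *: gelt K y)) ?galg_sum_gelt //.
by move=> y _; case: (P y); rewrite ?scale1r ?scale0r.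
Qed.

(** A composition with [k] parts has [k - 1] cuts, so its weight depends on [#|D|] alone, and its
    term contains [x] exactly when [D] contains the descents of [x]. *)
Lemma rhoE (K : fieldType) (m : nat) (x : 'S_m.+1) :
  rho m.+1 K x = \sum_(D : {set 'I_m.+1} | D \subset cuts m)
    (-1) ^+ #|D| / #|D|.+1%:R * (Des x \subset D)%:R.
Proof.
pose G (D : {set 'I_m.+1}) : K := (-1) ^+ #|D| / #|D|.+1%:R * (Des x \subset D)%:R.
rewrite /rho galg_sumE.
(* Grouping by the number of parts matches the outer sum of [rho]. The use of [inord] is exact
   because [D] has at most [m] elements. *)
rewrite [RHS](partition_big (fun D : {set 'I_m.+1} => inord #|D|.+1 : 'I_m.+2) xpredT) //=.
apply: eq_bigr => k _; rewrite galg_sumE.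
pose Q := [set q : k.-tuple 'I_m.+2 | is_composition m.+1 (map val q)].
pose h (q : k.-tuple 'I_m.+2) := comp_cuts m (map val q).
have h_inj : {in Q &, injective h}.
  move=> q r; rewrite !inE => qm rm /(comp_cuts_inj _ _ _ qm rm) E.
  by apply: val_inj; apply: (inj_map val_inj).
have hQ : h @: Q = [set D : {set 'I_m.+1} | (D \subset cuts m) && (inord #|D|.+1 == k)].
  apply/setP => D; rewrite inE; apply/imsetP/andP => [[q]|[Dm /eqP Dk]].
    rewrite inE => qm ->; rewrite comp_cuts_sub //; split=> //.
    by rewrite card_comp_cuts // size_map size_tuple inord_val.
  have [q qm qD] := comp_cuts_surj m D Dm.
  have q_le j : j \in q -> (j < m.+2)%N.
    case/andP: qm => _ /eqP <- jq; rewrite ltnS.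
    by rewrite sumnE (big_rem j) //= leq_addr.
  have sz : size (map inord q : seq 'I_m.+2) == k.
    rewrite size_map -Dk inordK; first by rewrite -(card_comp_cuts m q qm) qD.
    by rewrite !ltnS -[X in (_ <= X)%N](card_cuts m) subset_leq_card.
  have vK : map val (map inord q : seq 'I_m.+2) = q.
    by rewrite -map_comp map_id_in // => j /q_le jm /=; rewrite inordK.
  by exists (Tuple sz); rewrite ?inE /h /= vK.
transitivity (\sum_(D in h @: Q) G D); last by apply: eq_bigl => D; rewrite hQ inE.
rewrite big_imset //=; apply: eq_big => [q|q qm]; first by rewrite inE.
rewrite galgZ galg_sum_geltP /G /h card_comp_cuts // size_map size_tuple.
have <- : #|comp_cuts m (map val q)| = k.-1.
  apply: succn_inj; rewrite card_comp_cuts // size_map size_tuple prednK //.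
  by rewrite -(size_tuple q) -(size_map val) -(card_comp_cuts m _ qm).
congr (_ * _%:R); congr nat_of_bool; apply/forall_inP/subsetP => H i /H; by rewrite inE.
Qed.

(** After exchanging the sums, each [D] is weighted by its number of peakless shuffles, and the
    factor [2 ^ #|D|] turns the powers of -1 into powers of -2. *)
Lemma rho_tildeE (K : fieldType) (m : nat) (y : 'S_m.+1) :
  rho_tilde m.+1 K y = 2 * \sum_(D : {set 'I_m.+1} | (D \subset cuts m) && hits_peaks m y D)
    (- 2) ^+ #|D| / #|D|.+1%:R.
Proof.
rewrite /rho_tilde galgM; under eq_bigr => x _.
  rewrite rhoE galgZ galg_sum_geltP mulr_suml.
  over.
rewrite exchange_big mulr_sumr [RHS]big_mkcondr; apply: eq_bigr => D Dm /=.
transitivity ((-1) ^+ #|D| / #|D|.+1%:R * 2 *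
    \sum_x ((Des x \subset D) && (Peak (x^-1 * y)%g == set0))%:R : K).
  rewrite mulr_sumr; apply: eq_bigr => x _; rewrite -mulnb natrM; ring.
rewrite -natr_sum -big_mkcond /= sum1_card.
have := card_peakless_shuffles m y D Dm; rewrite cardsE => ->.
case: ifP => _; last by rewrite mulr0.
by rewrite natrX [(- 2) ^+ _]exprNn; ring.
Qed.

Theorem proposition7p7 (K : fieldType) (charK : [pchar K] =i pred0)
    (n : nat) (odd_n : odd n) :
  2^-1 *: rho_tilde n K =
  n%:R^-1 *: \sum_(pi : 'S_n)
    ((-1) ^+ peak pi *
     ((\prod_(1 <= i < (peak pi).+1) (2 * i)%:R) /
      (\prod_(1 <= i < (peak pi).+1) (n%:R - (2 * i)%:R)))) *: gelt K pi.
Proof.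
case: n odd_n => [//|m] /= evenm; apply/ffunP => y.
rewrite !galgZ galg_sum_gelt rho_tildeE mulKf; last first.
  by rewrite (pcharf0P K).1.
(* The pairs [peak_cuts] lie among the [m] cuts, and [m] is even because [n] is odd. *)
rewrite (sum_hitting_subset_weight K charK) ?card_cuts ?enum_uniq //.
(* The factor of index 0 in the denominator is [n] itself and supplies the prefactor [n%:R^-1]. *)
- rewrite -cardE -/(peak y) [\prod_(0 <= i < _) _]big_ltn // muln0 subr0 invfM.
  by rewrite -!mulrA [RHS]mulrCA; congr (_ * _); exact: mulrCA.
- by move=> i; rewrite mem_enum; apply: peak_cuts_sub.
- by move=> i; rewrite mem_enum; apply: card_peak_cuts.
- by move=> i j; rewrite !mem_enum; apply: peak_cuts_disjoint.
Qed.
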